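(* The class of all finite solvable SST-groups is closed under taking subgroups and epimorphic images.
   Context: All groups are finite. Two subgroups $A,B$ of a group permute if $AB=BA$. A supplement of $H$ in $G$ is a subgroup $K\le G$ with $G=HK$. A subgroup $H$ of a group $G$ is SS-permutable in $G$ if $H$ has a supplement $K$ in $G$ such that $H$ permutes with every Sylow subgroup of $K$ (for all primes). $G$ is an SST-group if SS-permutability is transitive: whenever $H\le K\le G$, $H$ is SS-permutable in $K$ and $K$ is SS-permutable in $G$, then $H$ is SS-permutable in $G$. *)

(* Defs.v *)
From mathcomp Require Import all_boot all_fingroup all_solvable.
Set Implicit Arguments.
Unset Strict Implicit.
Unset Printing Implicit Defensive.
Import GroupScope.

(* [commute], taken in the monoid of subsets of gT, is the set equality
   A * B = B * A: the two subgroups permute. *)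
Definition SS_permutable (gT : finGroupType) (H G : {group gT}) : Prop :=
  H \subset G /\
  exists K : {group gT},
    [/\ K \subset G, H * K = G
      & forall (p : nat) (P : {group gT}),
          prime p -> p.-Sylow(K) P -> commute (H : {set gT}) P].

Definition SST_group (gT : finGroupType) (G : {group gT}) : Prop :=
  forall H K : {group gT},
    H \subset K -> K \subset G ->
    SS_permutable H K -> SS_permutable K G -> SS_permutable H G.

(* Main.v *)
Require Import Defs.
From mathcomp Require Import all_boot all_fingroup all_solvable.
Set Implicit Arguments.
Unset Strict Implicit.
Unset Printing Implicit Defensive.
Import GroupScope.

(** The point is that a solvable SST-group is the same thing as a solvable
    group all of whose subgroups are SS-permutable, a property that plainly
    passes to subgroups.

    Indeed a subgroup H with a supplement P of prime power order in a group HP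
    is SS-permutable in HP: the only Sylow subgroups of P are P and 1
    ([SS_permutable_pgroup_supplement]).  In a solvable group G every proper
    subgroup H lies properly in such a product HP
    ([solvable_pgroup_extension]), so H is joined to G by a chain of subgroups,
    each SS-permutable in the next, and transitivity makes H SS-permutable in G
    ([solvable_SST_all_SS_permutable]).  SS-permutability in G is inherited by
    the intermediate subgroups ([SS_permutable_sub]), so every subgroup M of G
    has all its subgroups SS-permutable in M, and is thus an SST-group.

    Closure under epimorphic images needs no solvability: SS-permutability is
    preserved by both preimages and images under a morphism
    ([SS_permutable_morphpre], [SS_permutable_morphim]), so a chain of two
    SS-permutable embeddings in the image can be pulled back to G, composed
    there, and pushed forward again. *)

Lemma SS_permutable_pgroup_supplement (gT : finGroupType) (p : nat)
    (H P G : {group gT}) :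
  p.-group P -> H * P = G -> SS_permutable H G.
Proof.
move=> pP defG; split; first by rewrite -defG mulG_subl.
exists P; split=> // [|q Q _ sylQ]; first by rewrite -defG mulG_subr.
have [q_p | q'p] := eqVneq q p.
  have <-: P :=: Q by apply: (sub_pHall sylQ); rewrite ?q_p ?(pHall_sub sylQ).
  by apply/comm_group_setP; rewrite defG groupP.
have ->: Q :=: 1.
  apply/card1_trivg/(@pnat_1 p); first exact: pgroupS (pHall_sub sylQ) pP.
  by apply: (pi_pnat (pHall_pgroup sylQ)); rewrite !inE.
by rewrite /commute /= mulg1 mul1g.
Qed.

(** If N is minimal among the normal subgroups of G not contained in H, then
    H contains N', and a Sylow subgroup P of N not contained in H permutes with
    H because PN' is normal in G, N / N' being abelian. *)
Lemma solvable_pgroup_extension (gT : finGroupType) (G H : {group gT}) :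
  solvable G -> H \proper G ->
  exists p : nat, exists P K : {group gT},
    [/\ p.-group P, H * P = K, H \proper K & K \subset G].
Proof.
move=> solG /andP[sHG not_sGH].
pose gP (N : {group gT}) := (N <| G) && ~~ (N \subset H).
have [|N /mingroupP[/andP[nsNG not_sNH] minN] _] := @mingroup_exists gT gP G.
  by rewrite /gP normal_refl.
have [sNG nNG] := andP nsNG.
have nsN'N : N^`(1) <| N := der_normal 1 N.
have nsN'G : N^`(1) <| G := gFnormal_trans _ nsNG.
have sN'H : N^`(1) \subset H.
  apply/idPn=> not_sN'H.
  have eqN: N^`(1) :=: N by apply: minN; rewrite /gP ?nsN'G ?der_sub.
  have: N^`(1) \proper N.
    apply: (sol_der1_proper solG) => //.
    by apply: contraNneq not_sNH => ->; apply: sub1G.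
  by rewrite eqN properxx.
have [P sylNP not_sPH]: exists2 P : {group gT}, Sylow N P & ~~ (P \subset H).
  apply/exists_inP; apply: contraNT not_sNH => /exists_inPn sPH.
  rewrite -(Sylow_gen N) gen_subG; apply/bigcupsP => P /sPH.
  by rewrite negbK.
have [p _ sylP] := SylowP _ _ sylNP; have sPN := pHall_sub sylP.
have nN'P : P \subset 'N(N^`(1)) := subset_trans sPN (normal_norm nsN'N).
pose M := (N^`(1) <*> P)%G.
have sMN: M \subset N by rewrite join_subG der_sub.
have nsMG: M <| G.
  apply: char_normal_trans nsNG.
  apply: (char_from_quotient (H := N^`(1))).
  - by apply: normalS sMN nsN'N; apply: joing_subl.
  - exact: gFchar.
  - rewrite quotientYidl //=.
    rewrite (nilpotent_Hall_pcore _ (quotient_pHall nN'P sylP)) ?pcore_char //.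
    exact: abelian_nil (der_abelian 0 N).
have defHM: H <*> M = H * P.
  rewrite norm_joinEl ?(subset_trans sHG) ?normal_norm //=.
  by rewrite norm_joinEr // mulgA (mulGSid sN'H).
exists p, P, (H <*> M)%G; split=> //.
- exact: pHall_pgroup sylP.
- rewrite properE joing_subl /= defHM; apply: contra not_sPH.
  exact: subset_trans (mulG_subr _ _).
- by rewrite join_subG sHG (subset_trans sMN).
Qed.

Lemma SS_permutable_sub (gT : finGroupType) (H M G : {group gT}) :
  H \subset M -> M \subset G -> SS_permutable H G -> SS_permutable H M.
Proof.
move=> sHM sMG [_ [K [sKG defG permHK]]]; split=> //.
exists (K :&: M)%G; split=> [||p P p_pr sylP]; first exact: subsetIr.
  by rewrite /= group_modl // defG (setIidPr sMG).
(* A Sylow p-subgroup P of K :&: M is cut out on M by a Sylow p-subgroup Q of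
   K, so that HP = HQ :&: M by the modular law. *)
have [sPK sPM] := subsetIP (pHall_sub sylP).
have [Q sylQ sPQ] := Sylow_superset sPK (pHall_pgroup sylP).
have defP: Q :&: M = P.
  apply: (sub_pHall sylP).
  - exact: pgroupS (subsetIl _ _) (pHall_pgroup sylQ).
  - by rewrite subsetI sPQ.
  - by rewrite setSI ?(pHall_sub sylQ).
rewrite /commute /= -defP.
by rewrite [_ * _]group_modl // [in RHS]setIC [RHS]group_modr // setIC (permHK p).
Qed.

Lemma SS_permutable_morphpre (aT rT : finGroupType) (G : {group aT})
    (f : {morphism G >-> rT}) (H K : {group rT}) :
  K \subset f @* G -> SS_permutable H K ->
  SS_permutable (f @*^-1 H) (f @*^-1 K).
Proof.
move=> sKfG [sHK [B [sBK defK permHB]]]; split; first exact: morphpreS.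
have sHfG := subset_trans sHK sKfG; have sBfG := subset_trans sBK sKfG.
exists (f @*^-1 B)%G; split=> [||p P p_pr sylP]; first exact: morphpreS.
  by rewrite -morphpreMl ?defK.
have sPG: P \subset G by rewrite (subset_trans (pHall_sub sylP)) ?subsetIl.
have sylfP: p.-Sylow(B) (f @* P).
  by have:= morphim_pHall f sPG sylP; rewrite morphpreK.
(* The preimage of H contains the kernel of f, which thus disappears in its
   product with P. *)
have skH: 'ker f \subset f @*^-1 H by apply: ker_sub_pre.
have preHP: f @*^-1 (H * f @* P) = f @*^-1 H * P.
  by rewrite morphpreMl // morphimK // mulgA (mulGSid skH).
have prePH: f @*^-1 (f @* P * H) = P * f @*^-1 H.
  rewrite morphpreMr // morphimK // -(normC (subset_trans sPG (ker_norm f))).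
  by rewrite -mulgA (mulSGid skH).
by rewrite /commute /= -preHP -prePH (permHB p _ p_pr sylfP).
Qed.

Lemma SS_permutable_morphim (aT rT : finGroupType) (G : {group aT})
    (f : {morphism G >-> rT}) (H K : {group aT}) :
  K \subset G -> SS_permutable H K -> SS_permutable (f @* H) (f @* K).
Proof.
move=> sKG [sHK [B [sBK defK permHB]]]; split; first exact: morphimS.
have sHG := subset_trans sHK sKG; have sBG := subset_trans sBK sKG.
exists (f @* B)%G; split=> [||p P p_pr sylP]; first exact: morphimS.
  by rewrite -morphimMl ?defK.
(* Every Sylow subgroup of the image of B is the image of one of B. *)
have [R sylR] := Sylow_exists p B.
have sRG := subset_trans (pHall_sub sylR) sBG.
have [_ /morphimP[x Gx Bx ->] ->] := Sylow_trans (morphim_pHall f sRG sylR) sylP.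
have sylRx: p.-Sylow(B) (R :^ x) by rewrite pHallJ.
have sRxG: R :^ x \subset G := subset_trans (pHall_sub sylRx) sBG.
rewrite /commute /= -morphimJ // -morphimMl // -morphimMl //=.
by rewrite (permHB p _ p_pr sylRx).
Qed.

Lemma all_SS_permutable_SST (gT : finGroupType) (G : {group gT}) :
  (forall H : {group gT}, H \subset G -> SS_permutable H G) -> SST_group G.
Proof. by move=> permG H K sHK sKG _ _; apply/permG/(subset_trans sHK). Qed.

Lemma solvable_SST_all_SS_permutable (gT : finGroupType) (G H : {group gT}) :
  solvable G -> SST_group G -> H \subset G -> SS_permutable H G.
Proof.
move=> solG sstG; have [n] := ubnP (#|G| - #|H|).
elim: n H => // n IHn H; rewrite ltnS => le_n sHG.
have [/group_inj-> | ltHG] := eqVproper sHG.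
  exact: (@SS_permutable_pgroup_supplement _ 2 _ 1%G _ (pgroup1 _ _) (mulg1 _)).
have [p [P [K [pP defK ltHK sKG]]]] := solvable_pgroup_extension solG ltHG.
apply: (sstG _ K) => //; first exact: proper_sub.
  exact: SS_permutable_pgroup_supplement pP defK.
apply: IHn => //; apply: leq_trans le_n.
by rewrite ltn_sub2l ?proper_card.
Qed.

Theorem corollary1p10 (gT : finGroupType) (G : {group gT})
    (solG : solvable G) (sstG : SST_group G) :
  (forall H : {group gT}, H \subset G -> solvable H /\ SST_group H) /\
  (forall (rT : finGroupType) (Q : {group rT}) (f : {morphism G >-> rT}),
     f @* G = Q -> solvable Q /\ SST_group Q).
Proof.
split=> [M sMG | rT Q f defQ].
  split; first exact: solvableS solG.
  apply: all_SS_permutable_SST => H sHM.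
  apply: (SS_permutable_sub sHM sMG).
  exact: solvable_SST_all_SS_permutable (subset_trans sHM sMG).
split=> [|H K sHK sKQ permHK permKQ]; first by rewrite -defQ morphim_sol.
have sKfG: K \subset f @* G by rewrite defQ.
have sQfG: Q \subset f @* G by rewrite defQ.
have defG: f @*^-1 Q = G by rewrite -defQ morphimGK ?subsetIl.
have permH: SS_permutable (f @*^-1 H) G.
  apply: (sstG _ (f @*^-1 K)%G); rewrite ?morphpreS ?subsetIl //.
    exact: SS_permutable_morphpre.
  by have:= SS_permutable_morphpre sQfG permKQ; rewrite (group_inj defG).
have:= SS_permutable_morphim f (subxx G) permH.
by rewrite (group_inj (morphpreK (subset_trans sHK sKfG))) (group_inj defQ).
Qed.
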